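(* Let $A\in\mathbb{R}^{n\times n}$, $B\in\mathbb{R}^{n\times m}$, and let $x(0),x(1),\dots,x(T)$ be the state trajectory of $x(t+1)=Ax(t)+Bu(t)$ for some initial condition $x(0)$ and inputs $u(0),\dots,u(T-1)$. Set $$X_{0,T}=[x(1)\ x(2)\ \cdots\ x(T-1)],\quad X_{1,T}=[x(2)\ x(3)\ \cdots\ x(T)],\quad U_{0,T}=[u(1)\ u(2)\ \cdots\ u(T-1)].$$ Let $\mathcal{V}=\operatorname{Im}(V)\subseteq\mathbb{R}^n$ be an $(A,\operatorname{Im}(B))$-controlled invariant subspace, let $K$ be a matrix whose columns form a basis of $\operatorname{Ker}(X_{0,T})$, and define $$\gamma=-\big((I-VV^\dagger)X_{1,T}K\big)^\dagger(I-VV^\dagger)X_{1,T}X_{0,T}^\dagger VV^\dagger,\qquad F=U_{0,T}\big(X_{0,T}^\dagger+K\gamma\big).$$ If $\begin{bmatrix}U_{0,T} \\ X_{0,T}\end{bmatrix}$ has full row rank, then $(A+BF)\mathcal{V}\subseteq\mathcal{V}$.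
   Context: $M^\dagger$ denotes the Moore–Penrose pseudoinverse of $M$. A subspace $\mathcal{V}\subseteq\mathbb{R}^n$ is $(A,\operatorname{Im}(B))$-controlled invariant if $A\mathcal{V}\subseteq\mathcal{V}+\operatorname{Im}(B)$. *)

(* Defs.v *)
From HB Require Import structures.
From mathcomp Require Import all_boot all_order all_algebra reals.

Set Implicit Arguments.
Unset Strict Implicit.
Unset Printing Implicit Defensive.

Import Order.TTheory GRing.Theory Num.Theory.
Local Open Scope ring_scope.

Section Pseudoinverse.
Variable R : realFieldType.

(* The four Penrose equations, which determine P uniquely from M; MathComp's
   pinvmx need not satisfy the last two. *)
Definition is_pseudoinv m n (M : 'M[R]_(m, n)) : pred 'M[R]_(n, m) :=
  fun P => [&& M *m P *m M == M, P *m M *m P == P,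
               (M *m P)^T == M *m P & (P *m M)^T == P *m M].

Lemma is_pseudoinv_uniq m n (M : 'M[R]_(m, n)) (P Q : 'M[R]_(n, m)) :
  is_pseudoinv M P -> is_pseudoinv M Q -> P = Q.
Proof.
move=> /and4P[/eqP p1 /eqP p2 /eqP p3 /eqP p4].
move=> /and4P[/eqP q1 /eqP q2 /eqP q3 /eqP q4].
have eMP : M *m P = M *m Q.
  by rewrite -p3 -{1}q1 -(mulmxA _ M P) trmx_mul p3 q3 mulmxA p1.
have ePM : P *m M = Q *m M.
  by rewrite -p4 -{1}q1 !mulmxA -(mulmxA (P *m M)) trmx_mul p4 q4
             -mulmxA (mulmxA M) p1.
by rewrite -p2 ePM -mulmxA eMP mulmxA q2.
Qed.

Lemma mulmx_trmx_eq0 p (v : 'rV[R]_p) : v *m v^T = 0 -> v = 0.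
Proof.
move/matrixP/(_ 0 0); rewrite !mxE => /eqP; rewrite psumr_eq0; last first.
  by move=> j _; rewrite mxE -expr2 sqr_ge0.
move/allP=> v0; apply/rowP=> j; rewrite mxE.
by have := v0 j (mem_index_enum j); rewrite mxE -expr2 sqrf_eq0 => /eqP.
Qed.

Lemma gram_unitmx m n (M : 'M[R]_(m, n)) : row_free M -> M *m M^T \in unitmx.
Proof.
move=> freeM; rewrite -row_free_unit -kermx_eq0; apply/eqP/row_matrixP=> i.
rewrite row0; apply: (row_free_inj freeM); rewrite mul0mx.
apply: mulmx_trmx_eq0; set w := row i _.
have w0 : w *m (M *m M^T) = 0 by rewrite -row_mul mulmx_ker row0.
by rewrite trmx_mul mulmxA -(mulmxA w) w0 mul0mx.
Qed.

Lemma pseudoinv_exists m n (M : 'M[R]_(m, n)) : exists P, is_pseudoinv M P.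
Proof.
have [p [C [D [defM fullC freeD]]]] : exists p, exists C : 'M_(m, p),
    exists D : 'M_(p, n), [/\ C *m D = M, row_free C^T & row_free D].
  exists (\rank M), (col_base M), (row_base M).
  split; [exact: mulmx_base | | exact: row_base_free].
  by rewrite /row_free mxrank_tr (eqP (col_base_full M)).
have uD : D *m D^T \in unitmx by rewrite gram_unitmx.
have uC : C^T *m C \in unitmx by rewrite -{2}[C]trmxK gram_unitmx.
have symI q1 q2 (S : 'M[R]_(q1, q2)) : (invmx (S *m S^T))^T = invmx (S *m S^T).
  by rewrite trmx_inv trmx_mul trmxK.
set D' := D^T *m invmx (D *m D^T); set C' := invmx (C^T *m C) *m C^T.
have DD' : D *m D' = 1%:M by rewrite mulmxA mulmxV.
have C'C : C' *m C = 1%:M by rewrite -mulmxA mulVmx.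
have sD : (D' *m D)^T = D' *m D.
  by rewrite trmx_mul /D' trmx_mul trmxK symI mulmxA.
have sC : (C *m C')^T = C *m C'.
  have := symI _ _ C^T; rewrite trmxK => symC.
  by rewrite trmx_mul /C' trmx_mul trmxK symC mulmxA.
have eMP : M *m (D' *m C') = C *m C'.
  by rewrite -defM mulmxA -(mulmxA C) DD' mulmx1.
have ePM : D' *m C' *m M = D' *m D.
  by rewrite -defM mulmxA -(mulmxA D') C'C mulmx1.
exists (D' *m C'); apply/and4P; split; apply/eqP.
- by rewrite eMP -defM mulmxA -(mulmxA C) C'C mulmx1.
- by rewrite ePM mulmxA -(mulmxA D') DD' mulmx1.
- by rewrite eMP.
- by rewrite ePM.
Qed.

Definition pseudoinv m n (M : 'M[R]_(m, n)) : 'M[R]_(n, m) :=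
  xchoose (pseudoinv_exists M).

Lemma pseudoinvP m n (M : 'M[R]_(m, n)) : is_pseudoinv M (pseudoinv M).
Proof. exact: xchooseP. Qed.

End Pseudoinverse.

Section Subspaces.
Variable F : fieldType.

(* Matrices act on column vectors; note that mxalgebra's row-space operations
   and kermx use the opposite convention. *)
Definition colfun m n (M : 'M[F]_(m, n)) : 'Hom('cV[F]_n, 'cV[F]_m) :=
  linfun (mulmx M).

Definition im_mx m n (M : 'M[F]_(m, n)) : {vspace 'cV[F]_m} := limg (colfun M).

Definition ker_mx m n (M : 'M[F]_(m, n)) : {vspace 'cV[F]_n} := lker (colfun M).

Definition columns m n (M : 'M[F]_(m, n)) : seq 'cV[F]_m :=
  [seq col j M | j <- enum 'I_n].

Definition controlled_invariant n (A : 'M[F]_n) (W U : {vspace 'cV[F]_n}) : bool :=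
  (colfun A @: U <= U + W)%VS.

End Subspaces.

Section Data.
Variable R : nzRingType.

Definition trajectory n m (A : 'M[R]_n) (B : 'M[R]_(n, m)) (T : nat)
    (x : nat -> 'cV[R]_n) (u : nat -> 'cV[R]_m) : Prop :=
  forall t, (t < T)%N -> x t.+1 = A *m x t + B *m u t.

(* The matrix with columns s a, s (a + 1), ..., s (a + N - 1). *)
Definition data_mx p (s : nat -> 'cV[R]_p) (a N : nat) : 'M[R]_(p, N) :=
  \matrix_(i, j) s (a + j)%N i 0.

End Data.

(* Main.v *)
Require Import Defs.
From mathcomp Require Import all_boot all_order all_algebra reals.
Import Order.TTheory GRing.Theory Num.Theory.
Local Open Scope ring_scope.

(** Full row rank of [X0] gives [X0 X0^+ = 1], and [X0 K = 0], so that the data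
    equation [X1 = A X0 + B U0] yields [A + B F = X1 (X0^+ + K gamma)].  Full row
    rank of [U0] stacked on [X0] makes [U0 K] right invertible, so
    [Q X1 K = Q B U0 K] has the same image as [Q B]. Controlled invariance puts
    the image of [Q X1 X0^+ V] inside that image, where
    [(Q X1 K) (Q X1 K)^+] acts as the identity; hence [Q (A + B F) V = 0]. *)

Lemma colfunE {F : fieldType} {m n} (M : 'M[F]_(m, n)) v : colfun M v = M *m v.
Proof. by rewrite lfunE. Qed.

Lemma mem_im_mx {F : fieldType} {m n} (M : 'M[F]_(m, n)) v :
  M *m v \in im_mx M.
Proof. by rewrite -colfunE memv_img ?memvf. Qed.

Lemma mem_ker_mx {F : fieldType} {m n} (M : 'M[F]_(m, n)) v :
  (v \in ker_mx M) = (M *m v == 0).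
Proof. by rewrite memv_ker colfunE. Qed.

Lemma im_mxP {F : fieldType} {m n} (M : 'M[F]_(m, n)) v :
  reflect (exists w, v = M *m w) (v \in im_mx M).
Proof.
apply: (iffP idP) => [/memv_imgP[w _ ->] | [w ->]]; last exact: mem_im_mx.
by exists w; rewrite colfunE.
Qed.

(** The generalized inverse of [colfun N] is a section over its image, so lifting [M] column by
    column gives the factor. *)
Lemma im_mx_factor {F : fieldType} {m n p} (M : 'M[F]_(m, p)) (N : 'M[F]_(m, n)) :
  (forall j, col j M \in im_mx N) -> exists C, M = N *m C.
Proof.
move=> sMN; exists (\matrix_(i, j) ((colfun N)^-1)%VF (col j M) i 0).
apply/matrixP=> i j.
have /matrixP/(_ i 0) := limg_lfunVK (sMN j).
rewrite colfunE !mxE => <-.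
by apply: eq_bigr => l _; rewrite mxE.
Qed.

Lemma limg_colfun_mul {F : fieldType} {m n p} (M : 'M[F]_(m, n)) (N : 'M[F]_(n, p)) :
  (colfun M @: im_mx N)%VS = im_mx (M *m N).
Proof.
rewrite -limg_comp; congr (limg _); apply/lfunP=> v.
by rewrite comp_lfunE !colfunE mulmxA.
Qed.

Lemma span_columns {F : fieldType} {m n} (M : 'M[F]_(m, n)) :
  <<columns M>>%VS = im_mx M.
Proof.
apply/eqP; rewrite eqEsubv; apply/andP; split.
  by apply/span_subvP=> _ /mapP[j _ ->]; rewrite colE mem_im_mx.
apply/subvP=> _ /im_mxP[w ->].
have -> : M *m w = \sum_j w j 0 *: col j M.
  apply/colP=> i; rewrite mxE summxE; apply: eq_bigr => j _.
  by rewrite !mxE mulrC.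
apply: memv_suml => j _; apply/memvZ/memv_span/map_f.
by rewrite mem_enum.
Qed.

Lemma im_mx_row_mx {F : fieldType} {m n p} (M : 'M[F]_(m, n)) (N : 'M[F]_(m, p)) :
  (im_mx M + im_mx N <= im_mx (row_mx M N))%VS.
Proof.
apply/subvP=> _ /memv_addP[_ /im_mxP[v ->] [_ /im_mxP[w ->] ->]].
by rewrite -mul_row_col mem_im_mx.
Qed.

Lemma controlled_invariant_factor {F : fieldType} {n m r} {A : 'M[F]_n}
    {B : 'M[F]_(n, m)} {V : 'M[F]_(n, r)} :
  controlled_invariant A (im_mx B) (im_mx V) ->
  exists Y, exists Z, A *m V = V *m Y + B *m Z.
Proof.
rewrite /controlled_invariant limg_colfun_mul => sAV.
have [j|C ->] := im_mx_factor (A *m V) (row_mx V B).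
  apply: (subvP (im_mx_row_mx _ _)); apply: (subvP sAV).
  by rewrite colE mem_im_mx.
by exists (usubmx C), (dsubmx C); rewrite -mul_row_col vsubmxK.
Qed.

Lemma ker_basis_mul0 {F : fieldType} {m n k} {X : 'M[F]_(m, n)} {K : 'M[F]_(n, k)} :
  basis_of (ker_mx X) (columns K) -> X *m K = 0.
Proof.
move/span_basis=> defK; apply/matrixP=> i j.
have : col j K \in ker_mx X by rewrite -defK span_columns colE mem_im_mx.
by rewrite mem_ker_mx colE mulmxA -colE => /eqP/colP/(_ i); rewrite !mxE.
Qed.

Lemma ker_basis_factor {F : fieldType} {m n k p} {X : 'M[F]_(m, n)}
    {K : 'M[F]_(n, k)} {W : 'M[F]_(n, p)} :
  basis_of (ker_mx X) (columns K) -> X *m W = 0 -> exists L, W = K *m L.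
Proof.
move/span_basis=> defK XW0; apply: im_mx_factor => j.
by rewrite -span_columns defK mem_ker_mx colE mulmxA XW0 mul0mx.
Qed.

(** A matrix of full row rank can be cancelled on the right, here in the first Penrose equation. *)
Lemma row_free_pseudoinv {R : realFieldType} {m n} {M : 'M[R]_(m, n)} :
  row_free M -> M *m pseudoinv M = 1%:M.
Proof.
move=> freeM; have /and4P[/eqP MPM _ _ _] := pseudoinvP M.
by apply: (row_free_inj freeM); rewrite MPM mul1mx.
Qed.

Lemma row_free_col_mx_dsubmx {F : fieldType} {m n p} {U : 'M[F]_(m, p)}
    {X : 'M[F]_(n, p)} :
  row_free (col_mx U X) -> row_free X.
Proof.
case/row_freeP=> W; rewrite mul_col_mx (scalar_mx_block m n 1) => defW.
apply/row_freeP; exists (rsubmx W); have /(congr1 drsubmx) := defW.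
by rewrite -[W in LHS]hsubmxK !mul_mx_row -block_mxEv !block_mxKdr.
Qed.

(** Let [W1] be the left block of a right inverse of the stacked matrix. Then [U *m W1 = 1] and
    [X *m W1 = 0]; the latter puts the columns of [W1] in the kernel spanned by [K], so
    [W1 = K *m L]. *)
Lemma ker_basis_right_inv {F : fieldType} {m n p k} {U : 'M[F]_(m, p)}
    {X : 'M[F]_(n, p)} {K : 'M[F]_(p, k)} :
  row_free (col_mx U X) -> basis_of (ker_mx X) (columns K) ->
  exists L, U *m K *m L = 1%:M.
Proof.
case/row_freeP=> W; rewrite mul_col_mx (scalar_mx_block m n 1) => defW basK.
move: defW; rewrite -[W]hsubmxK !mul_mx_row -block_mxEv.
case/eq_block_mx=> UW _ XW _; have [L defL] := ker_basis_factor basK XW.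
by exists L; rewrite -mulmxA -defL.
Qed.

Lemma trajectory_data_mx {R : nzRingType} {n m T} {A : 'M[R]_n}
    {B : 'M[R]_(n, m)} {x u} a N :
  trajectory A B T x u -> (a + N <= T)%N ->
  data_mx x a.+1 N = A *m data_mx x a N + B *m data_mx u a N.
Proof.
move=> trj leT; apply/matrixP=> i j; rewrite mxE addSn trj; last first.
  by apply: leq_trans leT; rewrite ltn_add2l.
by rewrite !mxE; congr (_ + _); apply: eq_bigr => l _; rewrite mxE.
Qed.

Theorem mainTheorem3 (R : realType) (n m r k T : nat)
    (A : 'M[R]_n) (B : 'M[R]_(n, m))
    (x : nat -> 'cV[R]_n) (u : nat -> 'cV[R]_m)
    (calV : {vspace 'cV[R]_n}) (V : 'M[R]_(n, r)) (K : 'M[R]_(T - 1, k)) :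
  trajectory A B T x u ->
  let X0 := data_mx x 1 (T - 1) in
  let X1 := data_mx x 2 (T - 1) in
  let U0 := data_mx u 1 (T - 1) in
  calV = im_mx V ->
  controlled_invariant A (im_mx B) calV ->
  basis_of (ker_mx X0) (columns K) ->
  let Q := 1%:M - V *m pseudoinv V in
  let gamma := - pseudoinv (Q *m X1 *m K)
                 *m (Q *m X1 *m pseudoinv X0 *m V *m pseudoinv V) in
  let F := U0 *m (pseudoinv X0 + K *m gamma) in
  row_free (col_mx U0 X0) ->
  (colfun (A + B *m F) @: calV <= calV)%VS.
Proof.
move=> trj X0 X1 U0 -> ctrl basK Q gamma F freeUX.
have defX1 : X1 = A *m X0 + B *m U0.
  (* For [T = 0] the truncated [T - 1] is 0 and the bound [1 + (T - 1) <= T] fails, but the data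
     matrices have no columns. *)
  case: T @X0 @X1 @U0 K trj basK @Q @gamma @F freeUX => [|T] *.
    by apply/matrixP=> i [].
  by apply: trajectory_data_mx; first eassumption; rewrite subn1.
have XX' := row_free_pseudoinv (row_free_col_mx_dsubmx freeUX).
have XK0 := ker_basis_mul0 basK.
have [L UKL] := ker_basis_right_inv freeUX basK.
have [Y [Z defAV]] := controlled_invariant_factor ctrl.
have /and4P[/eqP VV'V _ _ _] := pseudoinvP V.
have defQ : Q = 1%:M - V *m pseudoinv V by [].
have QV0 : Q *m V = 0 by rewrite defQ mulmxBl mul1mx VV'V subrr.
clearbody Q.
pose M := Q *m X1 *m K.
have /and4P[/eqP MM'M _ _ _] := pseudoinvP M.
have X1K : X1 *m K = B *m (U0 *m K).
  by rewrite defX1 mulmxDl -!mulmxA XK0 mulmx0 add0r.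
have QB : Q *m B = M *m L.
  by rewrite /M -[Q *m X1 *m K]mulmxA X1K -!mulmxA [U0 *m _]mulmxA UKL mulmx1.
have XG : X0 *m (pseudoinv X0 + K *m gamma) = 1%:M.
  by rewrite mulmxDr [X0 *m (K *m _)]mulmxA XK0 mul0mx addr0.
have closed : A + B *m F = X1 *m (pseudoinv X0 + K *m gamma).
  by rewrite [in RHS]defX1 mulmxDl -2!mulmxA XG mulmx1.
have X1X' : X1 *m pseudoinv X0 = A + B *m (U0 *m pseudoinv X0).
  by rewrite defX1 mulmxDl -2!mulmxA XX' mulmx1.
have [C defN] : exists C, Q *m X1 *m pseudoinv X0 *m V = M *m C.
  (* Since [A *m V = V *m Y + B *m Z], the product [X1 *m pseudoinv X0 *m V] equals [V *m Y + B *m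
     (Z + U0 *m pseudoinv X0 *m V)]. [Q] kills the first term and turns [B] into [M *m L]. *)
  exists (L *m (Z + U0 *m pseudoinv X0 *m V)).
  rewrite mulmxA -QB -[Q *m X1 *m _]mulmxA X1X' -mulmxA mulmxDl defAV -addrA.
  by rewrite mulmxDr mulmxA QV0 mul0mx add0r -[B *m _ *m V]mulmxA -mulmxDr mulmxA.
(* The trailing [V *m pseudoinv V] in [gamma] is absorbed, as it fixes [V]. *)
have gammaV : gamma *m V = - (pseudoinv M *m (M *m C)).
  rewrite /gamma !mulNmx -mulmxA -defN; congr (- (_ *m _)).
  by rewrite -(mulmxA _ V) -(mulmxA _ _ V) VV'V.
clearbody gamma.
(* The left side becomes [M *m C - M *m pseudoinv M *m M *m C]. *)
have QclV : Q *m ((A + B *m F) *m V) = 0.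
  rewrite closed !mulmxA mulmxDr mulmxDl defN.
  rewrite [_ *m (K *m _)]mulmxA -/M -[_ *m gamma *m V]mulmxA gammaV.
  by rewrite mulmxN (mulmxA M) (mulmxA _ M) MM'M subrr.
rewrite limg_colfun_mul.
(* A matrix killed by [Q] equals [V *m pseudoinv V] times itself, so its image lies in that of
   [V]. *)
move/eqP: QclV; rewrite defQ mulmxBl mul1mx subr_eq0 => /eqP ->.
by apply/subvP=> _ /im_mxP[w ->]; rewrite -!mulmxA mem_im_mx.
Qed.
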